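(* Let $\mathbf S$ be a finite set and $\mathcal A=\{A_s\}_{s\in\mathbf S}\subset CQ(\mathbf X,\mathcal H)$ an AVcqC. Then $C_{A,d}(\mathcal A)=0$ if and only if $\mathcal A$ is m-symmetrizable.
   Context: $\mathbf X$ finite, $\mathcal H$ finite-dimensional complex Hilbert space, $CQ(\mathbf X,\mathcal H)$ the set of maps $\mathbf X\to\mathcal S(\mathcal H)$; $A_{s^l}(x^l):=A_{s_1}(x_1)\otimes\cdots\otimes A_{s_l}(x_l)$. An $(l,M_l)$ deterministic code is a family $(x_i^l,D_i^l)_{i=1}^{M_l}$ with $x_i^l\in\mathbf X^l$, $D_i^l\ge0$ on $\mathcal H^{\otimes l}$, $\sum_iD_i^l\le\mathbf 1$. $R\ge0$ is achievable under the maximal error criterion if there are $(l,M_l)$ deterministic codes with $\liminf_l\frac1l\log M_l\ge R$ and $\lim_{l}\max_{s^l\in\mathbf S^l}\max_{i\in[M_l]}\mathrm{tr}(A_{s^l}(x_i^l)(\mathbf 1-D_i^l))=0$; $C_{A,d}(\mathcal A)$ is the supremum of such $R$. $\mathcal A$ is called m-symmetrizable if for every $x,x'\in\mathbf X$, $\mathrm{conv}(\{A_s(x)\}_{s\in\mathbf S})\cap\mathrm{conv}(\{A_s(x')\}_{s\in\mathbf S})\neq\emptyset$. *)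

(* Defs.v *)
From HB Require Import structures.
From mathcomp Require Import all_boot all_order all_algebra.
From mathcomp Require Import all_classical all_reals all_analysis.
From mathcomp Require Import complex mxtens.
Set Implicit Arguments. Unset Strict Implicit. Unset Printing Implicit Defensive.
Import Order.TTheory GRing.Theory Num.Theory.
Local Open Scope classical_set_scope.
Local Open Scope ring_scope.

(* Complex numbers are R[i] = complex R for R : realType.
   The Hilbert space H is C^n; operators are n x n complex matrices. *)

Section QDefs.
Variable R : realType.
Local Notation C := R[i].

Definition adjmx m p (A : 'M[C]_(m, p)) : 'M[C]_(p, m) := (map_mx Num.conj A)^T.

Definition psd n (A : 'M[C]_n) : Prop :=
  forall v : 'cV[C]_n, 0 <= (adjmx v *m A *m v) 0 0.

Definition density n (A : 'M[C]_n) : Prop := psd A /\ \tr A = 1.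

Fixpoint tensn n l : ('I_l -> 'M[C]_n) -> 'M[C]_(n ^ l) :=
  match l return ('I_l -> 'M[C]_n) -> 'M[C]_(n ^ l) with
  | 0 => fun _ => 1%:M
  | l'.+1 => fun F =>
      castmx (esym (expnS n l'), esym (expnS n l'))
        (F ord0 *t tensn (fun k : 'I_l' => F (lift ord0 k)))
  end.

Variables (X S : finType) (n : nat).

Definition AVcqC (A : S -> X -> 'M[C]_n) : Prop := forall s x, density (A s x).

Definition tensA (A : S -> X -> 'M[C]_n) l (s : l.-tuple S) (x : l.-tuple X)
  : 'M[C]_(n ^ l) := tensn (fun k => A (tnth s k) (tnth x k)).

Record code (l : nat) := Code {
  csize : nat;
  cword : 'I_csize -> l.-tuple X;
  cdec  : 'I_csize -> 'M[C]_(n ^ l) }.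
Arguments csize {l} c.
Arguments cword {l} c i.
Arguments cdec {l} c i.

Definition code_valid l (c : code l) : Prop :=
  (forall i, psd (cdec c i)) /\ psd (1%:M - \sum_i cdec c i).

Definition max_err (A : S -> X -> 'M[C]_n) l (c : code l) : R :=
  \big[Num.max/0]_(s : l.-tuple S) \big[Num.max/0]_(i < csize c)
     complex.Re (\tr (tensA A s (cword c i) *m (1%:M - cdec c i))).

Definition achievable (A : S -> X -> 'M[C]_n) (r : R) : Prop :=
  0 <= r /\
  exists c : forall l, code l,
    (forall l, code_valid (c l)) /\
    (r%:E <= limn_einf (fun l => (ln (csize (c l))%:R / l%:R)%:E))%E /\
    (fun l => max_err A (c l) : R^o) @ \oo --> 0%R.

Definition CAd (A : S -> X -> 'M[C]_n) : \bar R :=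
  ereal_sup [set r%:E | r in achievable A].

Definition m_symmetrizable (A : S -> X -> 'M[C]_n) : Prop :=
  forall x x' : X, exists p q : S -> R,
    [/\ (forall s, 0 <= p s), \sum_s p s = 1,
        (forall s, 0 <= q s), \sum_s q s = 1 &
        \sum_s ((p s)%:C)%C *: A s x = \sum_s ((q s)%:C)%C *: A s x'].

End QDefs.

(* Main.v *)
(** If [A] is m-symmetrizable, then for any two codewords the jammer can mix its
    state sequences, independently in each position, so that both words produce
    the same average output; adding the two error probabilities shows that a
    code with two or more words has maximal error at least 1/2.

    Otherwise some [x], [x'] have disjoint output polytopes.  Gordan's
    alternative gives a separating hermitian matrix, which is rescaled to an
    effect [E] with [tr (A_s(x) E) >= 1/2 + e] and [tr (A_s(x') E) <= 1/2 - e]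
    for every state.  Measuring [E] on each factor turns the channel into a
    binary one in which the jammer flips a bit with probability at most
    [1/2 - e].  Minimum distance decoding confuses two words at Hamming distance
    [d] with probability at most [rho ^ d] for some [rho < 1], and a greedy
    choice produces exponentially many words whose pairwise [rho ^ d] is
    exponentially small. *)
Require Import Defs.
From HB Require Import structures.
From mathcomp Require Import all_boot all_order all_algebra.
From mathcomp Require Import all_classical all_reals all_analysis.
From mathcomp Require Import complex mxtens.
From mathcomp Require Import ring lra.
Set Implicit Arguments.
Unset Strict Implicit.
Unset Printing Implicit Defensive.
Import Order.TTheory GRing.Theory Num.Theory.
Local Open Scope ring_scope.

(** * Entrywise calculus of tensor powers *)

Section Tensor.
Variables (R : realType) (n : nat).
Local Notation C := R[i].

(** Mirrors the recursion of [tensn], so that an entry of a tensor product is a plain product of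
    entries at these digits. *)
Fixpoint tdigit l : 'I_(n ^ l) -> 'I_l -> 'I_n :=
  match l return 'I_(n ^ l) -> 'I_l -> 'I_n with
  | 0 => fun _ k => False_rect _ (notF (ltn_ord k))
  | l'.+1 => fun i k =>
      let ij := mxtens_unindex (cast_ord (expnS n l') i) in
      oapp (tdigit ij.2) ij.1 (unlift ord0 k)
  end.

Lemma tensnE l (F : 'I_l -> 'M[C]_n) i j :
  tensn F i j = \prod_k F k (tdigit i k) (tdigit j k).
Proof.
elim: l F i j => [|l IH] F i j /=.
  by rewrite big_ord0 mxE; case: i j => [[|i] //] ? [[|j] //] ?.
rewrite castmxE !mxE big_ord_recl unlift_none /= IH.
by rewrite !esymK; congr (_ * _); apply: eq_bigr => k _; rewrite liftK.
Qed.

Lemma eq_tensn l (F G : 'I_l -> 'M[C]_n) : F =1 G -> tensn F = tensn G.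
Proof. by move=> e; apply/matrixP => i j; rewrite !tensnE; under eq_bigr do rewrite e. Qed.

Lemma tensnZ l (a : 'I_l -> C) (F : 'I_l -> 'M[C]_n) :
  tensn (fun k => a k *: F k) = (\prod_k a k) *: tensn F.
Proof.
by apply/matrixP => i j; rewrite mxE !tensnE -big_split; apply: eq_bigr => k _; rewrite mxE.
Qed.

(** Multilinearity, by distributing the product in each entry. It serves both to expand
    position-wise mixtures over state sequences and to sum product outcomes to the identity. *)
Lemma tensn_sum l (T : finType) (F : 'I_l -> T -> 'M[C]_n) :
  tensn (fun k => \sum_t F k t) = \sum_(f : {ffun 'I_l -> T}) tensn (fun k => F k (f k)).
Proof.
apply/matrixP => i j; rewrite summxE tensnE.
under eq_bigr do rewrite summxE.
by rewrite bigA_distr_bigA; apply: eq_bigr => f _; rewrite tensnE.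
Qed.

Lemma tensn_adj l (F : 'I_l -> 'M[C]_n) :
  adjmx (tensn F) = tensn (fun k => adjmx (F k)).
Proof.
apply/matrixP => i j; rewrite !mxE !tensnE rmorph_prod.
by apply: eq_bigr => k _; rewrite !mxE.
Qed.

Lemma tensn1 l : tensn (fun _ : 'I_l => 1%:M) = 1%:M :> 'M[C]_(n ^ l).
Proof.
elim: l => [|l IH] //=; rewrite IH; case: _ / (esym _).
apply/matrixP => i j; rewrite castmx_id !mxE -natrM mulnb.
by rewrite -xpair_eqE -[X in X == _]surjective_pairing -surjective_pairing
  (can_eq (@mxtens_unindexK _ _)).
Qed.

Lemma tensn_mul l (F G : 'I_l -> 'M[C]_n) :
  tensn F *m tensn G = tensn (fun k => F k *m G k).
Proof.
elim: l F G => [|l IH] F G /=; first by rewrite mul1mx.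
by rewrite -IH -tensmx_mul; case: _ / (esym _); rewrite !castmx_id.
Qed.

Lemma tensn_tr l (F : 'I_l -> 'M[C]_n) : \tr (tensn F) = \prod_k \tr (F k).
Proof.
elim: l F => [|l IH] F /=; first by rewrite big_ord0 mxtrace1.
rewrite big_ord_recl -IH; case: _ / (esym _); rewrite castmx_id /mxtrace mulr_sum.
by apply: eq_bigr => i _; rewrite mxE.
Qed.

End Tensor.

(** * Positive semidefinite matrices *)

Section Positive.
Variable R : realType.
Local Notation C := R[i].

Lemma mxtrace_sum n (T : finType) (P : pred T) (F : T -> 'M[C]_n) :
  \tr (\sum_(t | P t) F t) = \sum_(t | P t) \tr (F t).
Proof. exact: raddf_sum. Qed.

Lemma adjmxM m n p (A : 'M[C]_(m, n)) (B : 'M[C]_(n, p)) :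
  adjmx (A *m B) = adjmx B *m adjmx A.
Proof. by rewrite /adjmx map_mxM trmx_mul. Qed.

Lemma adjmxK m n (A : 'M[C]_(m, n)) : adjmx (adjmx A) = A.
Proof. by apply/matrixP => i j; rewrite !mxE conjCK. Qed.

Lemma adjmxD m n (A B : 'M[C]_(m, n)) : adjmx (A + B) = adjmx A + adjmx B.
Proof. by apply/matrixP => i j; rewrite !mxE rmorphD. Qed.

Lemma adjmxB m n (A B : 'M[C]_(m, n)) : adjmx (A - B) = adjmx A - adjmx B.
Proof. by apply/matrixP => i j; rewrite !mxE rmorphB. Qed.

Lemma adjmx_self_ge0 m (v : 'cV[C]_m) : 0 <= (adjmx v *m v) 0 0.
Proof. by rewrite mxE sumr_ge0 // => i _; rewrite !mxE mulrC mul_conjC_ge0. Qed.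

Lemma psd_gram m n (B : 'M[C]_(m, n)) : psd (B *m adjmx B).
Proof.
move=> v; rewrite -{1}[B]adjmxK !mulmxA -adjmxM -mulmxA; exact: adjmx_self_ge0.
Qed.

(** Spectral theorem. Each eigenvalue is also given as a value of the quadratic form, so that sign
    information on the form passes to the spectrum. *)
Lemma normalmx_diag n (A : 'M[C]_n) : A *m adjmx A = adjmx A *m A ->
  exists (P : 'M[C]_n) (d : 'rV[C]_n), A = adjmx P *m diag_mx d *m P /\
    forall k, exists v : 'cV[C]_n, d 0 k = (adjmx v *m A *m v) 0 0.
Proof.
move=> nA; have /orthomx_spectralP : A \is normalmx.
  by apply/normalmxP; rewrite -map_trmx.
move: (spectral_unitarymx A) (spectral_diag A); set P := spectralmx A => Pu d.
have invP : invmx P = adjmx P by rewrite invmx_unitary // -map_trmx.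
have PP : P *m adjmx P = 1%:M by rewrite -invP mulmxV // spectral_unit.
rewrite invP => defA; exists P, d; split=> // k.
exists (adjmx P *m delta_mx k 0).
rewrite defA adjmxM adjmxK !mulmxA -[adjmx (delta_mx _ _) *m P *m _]mulmxA PP mulmx1.
rewrite -[_ *m P *m _]mulmxA PP mulmx1 -mulmxA mxE (bigD1 k) //= big1 => [|i /negPf ik].
  by rewrite -colE !mxE !eqxx rmorph1 mul1r addr0 mulr1n.
by rewrite !mxE ik /= rmorph0 mul0r.
Qed.

(* The skew-hermitian part has vanishing quadratic form, hence vanishing eigenvalues. *)
Lemma psd_adj n (A : 'M[C]_n) : psd A -> adjmx A = A.
Proof.
move=> hA; have form0 (v : 'cV[C]_n) : (adjmx v *m (A - adjmx A) *m v) 0 0 = 0.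
  (* Nonnegative complex numbers are real, so the form of the adjoint, being the conjugate, has the
     same value. *)
  have hadj : (adjmx v *m adjmx A *m v) 0 0 = (adjmx v *m A *m v) 0 0.
    rewrite -[RHS]geC0_conj // (_ : _ *m v = adjmx (adjmx v *m A *m v)).
      by rewrite mxE [LHS]mxE.
    by rewrite !adjmxM adjmxK mulmxA.
  by rewrite mulmxBr mulmxBl mxE [X in _ + X]mxE hadj subrr.
have [P [d [defN hd]]] : exists (P : 'M[C]_n) (d : 'rV[C]_n), A - adjmx A = adjmx P *m diag_mx d *m P /\
    forall k, exists v : 'cV[C]_n, d 0 k = (adjmx v *m (A - adjmx A) *m v) 0 0.
  apply: normalmx_diag; have -> : adjmx (A - adjmx A) = - (A - adjmx A).
    by rewrite adjmxB adjmxK opprB.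
  by rewrite mulmxN mulNmx.
have d0 : d = 0 by apply/rowP => k; have [v ->] := hd k; rewrite form0 mxE.
apply/esym/eqP; rewrite -subr_eq0 defN d0.
by rewrite (_ : diag_mx 0 = 0) ?mulmx0 ?mul0mx // linear0.
Qed.

Lemma psd_factor n (A : 'M[C]_n) : psd A -> exists B : 'M[C]_n, A = B *m adjmx B.
Proof.
move=> hA; have [|P [d [defA hd]]] := @normalmx_diag n A; first by rewrite psd_adj.
have d0 k : 0 <= d 0 k by have [v ->] := hd k; exact: hA.
pose D : 'M[C]_n := diag_mx (map_mx sqrtC d).
exists (adjmx P *m D); rewrite adjmxM adjmxK defA !mulmxA.
congr (_ *m _); rewrite -mulmxA; congr (_ *m _).
have -> : adjmx D = D.
  apply/matrixP => i j; rewrite !mxE eq_sym; case: eqP => [->|_]; last by rewrite mulr0n rmorph0.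
  by rewrite mulr1n geC0_conj // sqrtC_ge0.
by rewrite mulmx_diag; congr diag_mx; apply/rowP => k; rewrite !mxE -expr2 sqrtCK.
Qed.

(** Writing [A] as [F *m adjmx F], cyclicity gives the trace of [adjmx F *m B *m F], whose diagonal
    entries are values of the form of [B] on the columns of [F]. *)
Lemma trace_mul_psd_ge0 n (A B : 'M[C]_n) : psd A -> psd B -> 0 <= \tr (A *m B).
Proof.
move=> /psd_factor [F ->] hB; rewrite mxtrace_mulC mulmxA mxtrace_mulC mulmxA.
apply: sumr_ge0 => i _; have := hB (F *m delta_mx i 0).
rewrite adjmxM -!mulmxA mxE (bigD1 i) //= big1 => [|j /negPf ji]; last first.
  by rewrite !mxE ji /= rmorph0 mul0r.
by rewrite !mulmxA -colE !mxE !eqxx rmorph1 mul1r addr0.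
Qed.

Lemma tensn_psd n l (F : 'I_l -> 'M[C]_n) : (forall k, psd (F k)) -> psd (tensn F).
Proof.
move=> /(fun h k => psd_factor (h k)) /choice [B hB].
rewrite (eq_tensn hB) -tensn_mul -tensn_adj; exact: psd_gram.
Qed.

Lemma psd0 n : psd (0 : 'M[C]_n).
Proof. by move=> v; rewrite mulmx0 mul0mx mxE. Qed.

Lemma psdD n (A B : 'M[C]_n) : psd A -> psd B -> psd (A + B).
Proof. by move=> hA hB v; rewrite mulmxDr mulmxDl mxE addr_ge0. Qed.

Lemma psd_sum n (T : finType) (P : pred T) (F : T -> 'M[C]_n) :
  (forall t, P t -> psd (F t)) -> psd (\sum_(t | P t) F t).
Proof. move=> hF; elim/big_ind: _ => //; [exact: psd0 | exact: psdD]. Qed.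

Lemma psdZ n (a : C) (A : 'M[C]_n) : 0 <= a -> psd A -> psd (a *: A).
Proof. by move=> ha hA v; rewrite -scalemxAr -scalemxAl mxE mulr_ge0. Qed.

End Positive.

(** * Gordan's alternative and separation of polytopes *)

Section Gordan.
Variables (R : realFieldType) (I T : finType).
Implicit Types (f g : I -> R) (d : T -> I -> R) (s : seq T).

Definition dot f g : R := \sum_i f i * g i.

Lemma dot_lin f g h a : dot (fun i => f i + a * g i) h = dot f h + a * dot g h.
Proof. by rewrite /dot mulr_sumr -big_split; apply: eq_bigr => i _; rewrite mulrDl mulrA. Qed.

Lemma dotC f g : dot f g = dot g f.
Proof. by apply: eq_bigr => i _; rewrite mulrC. Qed.

Lemma dot_self_gt0 f i : f i != 0 -> 0 < dot f f.
Proof.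
move=> fi; rewrite /dot (bigD1 i) //= ltr_pwDl //.
  by rewrite -expr2 exprn_even_gt0.
by apply: sumr_ge0 => j _; rewrite -expr2 sqr_ge0.
Qed.

Lemma pos_perturb s (F G : T -> R) : {in s, forall t, 0 < F t} ->
  exists2 e : R, 0 < e & {in s, forall t, 0 < F t + e * G t}.
Proof.
move=> hF; suff [e e0 he] : exists2 e : R, 0 < e &
    forall e' : R, 0 < e' <= e -> {in s, forall t, 0 < F t + e' * G t}.
  by exists e => //; apply: he; rewrite e0 lexx.
elim: s hF => [|t s IH] hF; first by exists 1.
have [|e e0 he] := IH; first by move=> u us; apply: hF; rewrite inE us orbT.
have Ft : 0 < F t by apply: hF; rewrite mem_head.
have G1 : 0 < 1 + `|G t| by rewrite ltr_pwDl.
exists (Num.min e (F t / (1 + `|G t|))); first by rewrite lt_min e0 divr_gt0.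
move=> e'; rewrite le_min => /and3P[e'0 e'e e'F] u; rewrite inE => /orP[/eqP->|]; last first.
  by apply: he; rewrite e'0.
move: e'F; rewrite ler_pdivlMr // => e'F.
have : - (e' * G t) <= e' * `|G t| by rewrite -mulrN ler_pM2l // -normrN ler_norm.
by move: e'F; rewrite mulrDr; lra.
Qed.

(** Induction on the list. Let [f] be positive on [s]. If [f] is negative at [d e], the other
    vectors are projected along [d e] to the kernel of [f] and the induction hypothesis is applied
    again. If [f] vanishes at [d e], it is tilted towards [d e], unless [d e = 0], which is itself a
    dependence. *)
Lemma gordan_seq s d : uniq s ->
  (exists f, {in s, forall t, 0 < dot f (d t)}) \/
  (exists w : T -> R, [/\ forall t, 0 <= w t, 0 < \sum_(t <- s) w t &
     forall i, \sum_(t <- s) w t * d t i = 0]).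
Proof.
elim: s d => [|e s IH] d /=; first by left; exists (fun _ => 0).
case/andP=> es us.
have ext (w : T -> R) (c : R) (hw : forall t, 0 <= w t) (hc : 0 <= c) :
    0 < c + \sum_(t <- s) w t ->
    (forall i, c * d e i + \sum_(t <- s) w t * d t i = 0) ->
    exists w : T -> R, [/\ forall t, 0 <= w t, 0 < \sum_(t <- e :: s) w t &
     forall i, \sum_(t <- e :: s) w t * d t i = 0].
  move=> h1 h2; exists (fun t => if t == e then c else w t).
  have off t : t \in s -> (if t == e then c else w t) = w t.
    by case: eqP => // ->; rewrite (negPf es).
  split=> [t|| i]; first by case: ifP.
  - by rewrite big_cons eqxx (eq_big_seq w).
  - rewrite big_cons eqxx (eq_big_seq (fun t => w t * d t i)) //.
    by move=> t ts; rewrite off.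
have [[f hf]|[w [w0 w1 wd]]] := IH d us; last first.
  right; apply: (ext w 0) => // [|i]; first by rewrite add0r.
  by rewrite mul0r add0r.
have [fe|fe|fe] := ltgtP 0 (dot f (d e)).
- by left; exists f => t; rewrite inE => /orP[/eqP->//|]; apply: hf.
- have lift_c t : t \in s -> 0 < - dot f (d t) / dot f (d e).
    by move=> ts; rewrite mulNr -mulrN -invrN divr_gt0 ?oppr_gt0 // hf.
  (* For [t] in [s] this puts [d t + c t * d e] in the kernel of [f]; the maximum with 0 keeps [c]
     nonnegative off [s]. *)
  pose c t := Num.max 0 (- dot f (d t) / dot f (d e)).
  have cs t : t \in s -> c t = - dot f (d t) / dot f (d e).
    by move=> /lift_c ct; rewrite /c max_r // ltW.
  have c0 t : 0 <= c t by rewrite /c le_max lexx.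
  pose d' t i := d t i + c t * d e i.
  have [[g hg]|[w [w0 w1 wd]]] := IH d' us; last first.
    right; apply: (ext w (\sum_(t <- s) w t * c t)) => // [||i].
    + by apply: sumr_ge0 => t _; rewrite mulr_ge0.
    + by rewrite ltr_wpDl //; apply: sumr_ge0 => t _; rewrite mulr_ge0.
    + rewrite -[RHS](wd i) mulr_suml -big_split; apply: eq_bigr => t _.
      by rewrite /d' mulrDr mulrA addrC.
  (* [g'] vanishes at [d e] and takes at [d t] the positive value of [g] at [d' t]; subtracting a
     little of [f] makes it positive at [d e] too. *)
  pose g' i := g i + (- (dot g (d e) / dot f (d e))) * f i.
  have fe' : dot f (d e) != 0 by rewrite lt_eqF.
  have g'e : dot g' (d e) = 0 by rewrite dot_lin; field.
  have g's t : t \in s -> 0 < dot g' (d t).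
    move=> ts; have := hg t ts; rewrite /d' dotC dot_lin !(dotC _ g) (cs t ts) dot_lin.
    by congr (0 < _); field.
  have [x x0 hx] := pos_perturb (fun t => - dot f (d t)) g's.
  left; exists (fun i => g' i + (- x) * f i) => t; rewrite dot_lin.
  rewrite inE => /orP[/eqP->|ts]; first by rewrite g'e add0r mulNr -mulrN mulr_gt0 // oppr_gt0.
  by have := hx t ts; rewrite mulrN mulNr.
- have [e0|] := boolP [forall i, d e i == 0].
    right; apply: (ext (fun _ => 0) 1) => // [|i]; first by rewrite big1 // addr0.
    by rewrite (eqP (forallP e0 i)) mulr0 add0r big1 // => t _; rewrite mul0r.
  rewrite negb_forall => /existsP[i /dot_self_gt0 ee].
  have [x x0 hx] := pos_perturb (fun t => dot (d e) (d t)) hf.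
  left; exists (fun i => f i + x * d e i) => t; rewrite dot_lin.
  rewrite inE => /orP[/eqP->|ts]; first by rewrite -fe add0r mulr_gt0.
  exact: hx.
Qed.

Lemma gordan d :
  (exists f, forall t, 0 < dot f (d t)) \/
  (exists w : T -> R, [/\ forall t, 0 <= w t, \sum_t w t = 1 &
     forall i, \sum_t w t * d t i = 0]).
Proof.
have [[f hf]|[w [w0 w1 wd]]] := @gordan_seq (index_enum T) d (index_enum_uniq _).
  by left; exists f => t; apply: hf; rewrite mem_index_enum.
right; exists (fun t => w t / \sum_t w t); split=> [t|| i].
- by rewrite divr_ge0 // ltW.
- by rewrite -mulr_suml divff // gt_eqF.
- under eq_bigr do rewrite mulrAC.
  by rewrite -mulr_suml wd mul0r.
Qed.

End Gordan.

(** Gordan's alternative for all differences [a s - b t]: the marginals of the weights on pairs are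
    the two convex combinations. *)
Lemma polytope_separation (R : realFieldType) (I S : finType) (a b : S -> I -> R) :
  (exists f, forall s t, dot f (b t) < dot f (a s)) \/
  (exists p q : S -> R, [/\ forall s, 0 <= p s, \sum_s p s = 1, forall s, 0 <= q s,
     \sum_s q s = 1 & forall i, \sum_s p s * a s i = \sum_s q s * b s i]).
Proof.
have [[f hf]|[w [w0 w1 wd]]] := gordan (fun st : S * S => fun i => a st.1 i - b st.2 i).
  left; exists f => s t; rewrite -subr_gt0; have := hf (s, t).
  by rewrite /dot -sumrB; under eq_bigr do rewrite mulrBr.
right; exists (fun s => \sum_t w (s, t)), (fun t => \sum_s w (s, t)).
split=> [s||t||i]; do ?by apply: sumr_ge0.
- by rewrite pair_bigA -w1; apply: eq_bigr => -[].
- by rewrite exchange_big pair_bigA -w1; apply: eq_bigr => -[].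
apply/eqP; rewrite -subr_eq0 -[X in _ == X](wd i); apply/eqP.
under eq_bigr do rewrite mulr_suml.
under [X in _ - X]eq_bigr do rewrite mulr_suml.
rewrite [X in _ - X]exchange_big !pair_bigA -sumrB.
by apply: eq_bigr => -[s t] _ /=; rewrite mulrBr.
Qed.

(** * Rescaling a hermitian matrix to an effect *)

Section Effect.
Variable R : realType.
Local Notation C := R[i].
Implicit Types x y : C.

Lemma cReD x y : complex.Re (x + y) = complex.Re x + complex.Re y.
Proof. by case: x y => [? ?] []. Qed.

Lemma cReZ (a : R) x : complex.Re (a%:C%C * x) = a * complex.Re x.
Proof. by case: x => b c /=; rewrite mul0r subr0. Qed.

Lemma cRe_sum (T : finType) (P : pred T) (F : T -> C) :
  complex.Re (\sum_(t | P t) F t) = \sum_(t | P t) complex.Re (F t).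
Proof. by apply: (big_morph _ cReD). Qed.

Lemma cRe_conj x : complex.Re (Num.conj x) = complex.Re x.
Proof. by case: x. Qed.

Lemma ge0_cReK x : 0 <= x -> (complex.Re x)%:C%C = x.
Proof. by move=> x0; rewrite RRe_real // ger0_real. Qed.

Lemma cRe_ge0 x : 0 <= x -> 0 <= complex.Re x.
Proof. by rewrite lecE => /andP[]. Qed.

Variable n : nat.

Lemma adjmxZ (a : R) m (N : 'M[C]_(m, n)) : adjmx (a%:C%C *: N) = a%:C%C *: adjmx N.
Proof.
apply/matrixP => i j; rewrite !mxE rmorphM; congr (_ * _).
exact: conjc_real.
Qed.

Lemma adjmx1 : adjmx 1%:M = 1%:M :> 'M[C]_n.
Proof. by rewrite /adjmx map_mx1 trmx1. Qed.

Lemma form_le (N : 'M[C]_n) (v : 'cV[C]_n) :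
  `|(adjmx v *m N *m v) 0 0| <= (\sum_k \sum_j `|N j k|) * (adjmx v *m v) 0 0.
Proof.
have vi i : `|v i 0| ^+ 2 <= (adjmx v *m v) 0 0.
  rewrite mxE (bigD1 i) //= !mxE [_^* * _]mulrC -normCK lerDl.
  by apply: sumr_ge0 => j _; rewrite !mxE mulrC mul_conjC_ge0.
have vij i j : `|v i 0| * `|v j 0| <= (adjmx v *m v) 0 0.
  have [h|/ltW h] := real_leP (normr_real (v i 0)) (normr_real (v j 0)).
    by apply: le_trans (vi j); rewrite expr2 ler_wpM2r.
  by apply: le_trans (vi i); rewrite expr2 ler_wpM2l.
rewrite mxE; apply: le_trans (ler_norm_sum _ _ _) _.
rewrite mulr_suml; apply: ler_sum => k _; rewrite mxE normrM.
apply: le_trans (ler_wpM2r (normr_ge0 _) (ler_norm_sum _ _ _)) _.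
rewrite !mulr_suml; apply: ler_sum => j _.
move: vij; set q := (adjmx v *m v) 0 0 => vij.
by rewrite !mxE !normrM norm_conjC -mulrA mulrCA ler_wpM2l.
Qed.

(** A hermitian form is real; real witnesses let the later estimates be carried out in [R]. *)
Lemma hermitian_form_bound (N : 'M[C]_n) : adjmx N = N ->
  exists2 k : R, 0 <= k & forall v : 'cV[C]_n, exists q r : R,
    [/\ (adjmx v *m v) 0 0 = q%:C%C, (adjmx v *m N *m v) 0 0 = r%:C%C,
        0 <= q & `|r| <= k * q].
Proof.
move=> hN; have := form_le N; set K := \sum_k _ => hK.
have K0 : 0 <= K by apply: sumr_ge0 => k _; apply: sumr_ge0.
exists (complex.Re K) => [|v]; first exact: cRe_ge0.
have q0 := adjmx_self_ge0 v.
have rr : (adjmx v *m N *m v) 0 0 \is Num.real.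
  apply/CrealP; rewrite [in RHS](_ : _ *m v = adjmx (adjmx v *m N *m v)).
    by rewrite [in RHS]mxE [in RHS]mxE.
  by rewrite !adjmxM adjmxK hN mulmxA.
exists (complex.Re ((adjmx v *m v) 0 0)), (complex.Re ((adjmx v *m N *m v) 0 0)).
rewrite ge0_cReK // RRe_real //; split=> //; first exact: cRe_ge0.
have := hK v; rewrite -{1}(ge0_cReK q0) -{1}(RRe_real rr) -{1}(ge0_cReK K0).
by rewrite normc_def /= expr0n addr0 sqrtr_sqr -rmorphM lecR.
Qed.

Lemma hermitian_scale_effect (N : 'M[C]_n) : adjmx N = N ->
  exists2 t : R, 0 < t &
    psd ((2^-1)%:C%C *: 1%:M + t%:C%C *: N) /\ psd ((2^-1)%:C%C *: 1%:M + (- t)%:C%C *: N).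
Proof.
move=> /hermitian_form_bound[k k0 hk].
have k1 : 0 < 1 + k by rewrite ltr_pwDl.
(* Then [t * k < 1/2]; the summand 1 keeps [t] positive even when [k = 0]. *)
pose t := (2 * (1 + k))^-1; have t0 : 0 < t by rewrite invr_gt0 mulr_gt0.
exists t => //; have bound (q r : R) : 0 <= q -> `|r| <= k * q -> `|t * r| <= 2^-1 * q.
  move=> q0 rq; rewrite normrM gtr0_norm // /t invfM -mulrA ler_pM2l ?invr_gt0 //.
  rewrite ler_pdivrMl // mulrDl mul1r; apply: le_trans rq _.
  by rewrite lerDr.
have form (a b : R) (v : 'cV[C]_n) :
    (adjmx v *m (a%:C%C *: 1%:M + b%:C%C *: N) *m v) 0 0
    = a%:C%C * (adjmx v *m v) 0 0 + b%:C%C * (adjmx v *m N *m v) 0 0.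
  by rewrite mulmxDr mulmxDl -!scalemxAr -!scalemxAl mulmx1 mxE [X in X + _]mxE [X in _ + X]mxE.
split=> v; have [q [r [eq er q0 /(bound q r q0)]]] := hk v;
  rewrite ler_norml => /andP[h1 h2]; rewrite form eq er -!rmorphM -rmorphD ler0c.
  by rewrite -lerBlDl sub0r.
by rewrite mulNr subr_ge0.
Qed.

End Effect.

(** Take the midpoint and half the distance between the minimum of [G] and the maximum of [F]; over
    an empty [S] any positive [e] works. *)
Lemma finite_gap (R : realFieldType) (S : finType) (F G : S -> R) :
  (forall s t, F t < G s) ->
  exists m e : R, [/\ 0 < e, forall s, m + e <= G s & forall t, F t <= m - e].
Proof.
move=> FG; case: (pickP (fun _ : S => true)) => [s0 _|S0]; last first.
  by exists 0, 1; split=> // s; have := S0 s.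
case: (arg_minP G (i0 := s0) (P := predT) isT) => i _ hi.
case: (arg_maxP F (i0 := s0) (P := predT) isT) => j _ hj.
exists ((G i + F j) / 2), ((G i - F j) / 2); split=> [|s|t].
- by rewrite divr_gt0 // subr_gt0.
- by apply: le_trans (hi s isT); lra.
- by apply: le_trans (hj t isT) _; lra.
Qed.

(** * Measurement separating two output polytopes *)

Section SeparatingEffect.
Variables (R : realType) (n : nat).
Local Notation C := R[i].

(** Real coordinates of a complex matrix, to which separation over an ordered field applies. *)
Definition mxcoord (A : 'M[C]_n) (u : 'I_n * 'I_n * bool) : R :=
  if u.2 then complex.Im (A u.1.1 u.1.2) else complex.Re (A u.1.1 u.1.2).

Lemma mxcoord_inj (A B : 'M[C]_n) : mxcoord A =1 mxcoord B -> A = B.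
Proof.
move=> AB; apply/matrixP => i j; apply/eqP; rewrite eq_complex.
by have := AB (i, j, true); have := AB (i, j, false); rewrite /mxcoord /= => -> ->; rewrite !eqxx.
Qed.

Lemma mxcoord_comb (S : finType) (p : S -> R) (a : S -> 'M[C]_n) u :
  mxcoord (\sum_s (p s)%:C%C *: a s) u = \sum_s p s * mxcoord (a s) u.
Proof.
have ImD (x y : C) : complex.Im (x + y) = complex.Im x + complex.Im y by case: x y => [? ?] [].
case: u => -[i j] []; rewrite /mxcoord /= summxE.
  rewrite (big_morph _ ImD (erefl : complex.Im 0 = 0)); apply: eq_bigr => s _.
  by rewrite mxE; case: (a s i j) => x y /=; rewrite mul0r addr0.
by rewrite cRe_sum; apply: eq_bigr => s _; rewrite mxE cReZ.
Qed.

(** The adjoint of the matrix with coordinates [f]; the real part of the trace pairing with it is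
    the real inner product. *)
Definition coordmx (f : 'I_n * 'I_n * bool -> R) : 'M[C]_n :=
  \matrix_(i, j) Complex (f (j, i, false)) (- f (j, i, true)).

Lemma dot_coordmx f (A : 'M[C]_n) : complex.Re (\tr (A *m coordmx f)) = dot f (mxcoord A).
Proof.
have -> : dot f (mxcoord A) = \sum_i \sum_j \sum_b f (i, j, b) * mxcoord A (i, j, b).
  by rewrite !pair_bigA; apply: eq_bigr => -[[i j] b] _.
rewrite cRe_sum; apply: eq_bigr => i _; rewrite mxE cRe_sum; apply: eq_bigr => j _.
rewrite big_bool /mxcoord /= mxE; case: (A i j) => x y /=.
by rewrite mulrN opprK addrC ![_ * f _]mulrC.
Qed.

(** For hermitian [A] the traces against [H] and its adjoint are conjugate, so a separator may be
    replaced by its hermitian part. *)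
Lemma trace_hermitianize (A H : 'M[C]_n) : psd A ->
  complex.Re (\tr (A *m (H + adjmx H))) = 2 * complex.Re (\tr (A *m H)).
Proof.
move=> /psd_adj hA; rewrite mulmxDr mxtraceD cReD.
have -> : A *m adjmx H = adjmx (H *m A) by rewrite adjmxM hA.
have -> : \tr (adjmx (H *m A)) = Num.conj (\tr (H *m A)).
  by rewrite rmorph_sum; apply: eq_bigr => i _; rewrite !mxE.
by rewrite cRe_conj mxtrace_mulC mulr_natl mulr2n.
Qed.

Lemma separating_effect (S : finType) (a b : S -> 'M[C]_n) :
  (forall s, density (a s)) -> (forall s, density (b s)) ->
  (exists p q : S -> R, [/\ forall s, 0 <= p s, \sum_s p s = 1, forall s, 0 <= q s,
     \sum_s q s = 1 & \sum_s (p s)%:C%C *: a s = \sum_s (q s)%:C%C *: b s]) \/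
  (exists (E : 'M[C]_n) (e : R), [/\ psd E, psd (1%:M - E), 0 < e,
     forall s, 2^-1 + e <= complex.Re (\tr (a s *m E)) &
     forall s, complex.Re (\tr (b s *m E)) <= 2^-1 - e]).
Proof.
move=> da db; have [[f hf]|[p [q [p0 p1 q0 q1 pq]]]] :=
    polytope_separation (fun s => mxcoord (a s)) (fun s => mxcoord (b s)); last first.
  left; exists p, q; split=> //; apply: mxcoord_inj => u.
  by rewrite !mxcoord_comb.
right; have [m [e [e0 ha hb]]] := finite_gap hf.
(* The hermitianized pairing doubles [f], and states have trace one, so this shift moves the
   threshold [m] to 0; adding half the identity then puts it at 1/2. *)
pose N := coordmx f + adjmx (coordmx f) + (- (2 * m))%:C%C *: 1%:M.
have hN : adjmx N = N.
  by rewrite !adjmxD adjmxK adjmxZ adjmx1 [adjmx _ + _]addrC.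
have [t t0 [tp tm]] := hermitian_scale_effect hN.
pose E := (2^-1)%:C%C *: 1%:M + t%:C%C *: N.
have trE (A : 'M[C]_n) : density A ->
    complex.Re (\tr (A *m E)) = 2^-1 + t * (2 * (dot f (mxcoord A) - m)).
  move=> [pA tA]; rewrite !mulmxDr !mxtraceD -!scalemxAr !mxtraceZ !mulmx1 tA cReD !cReZ.
  rewrite mulmxDr mxtraceD -scalemxAr mulmx1 mxtraceZ tA.
  rewrite cReD cReZ trace_hermitianize // dot_coordmx /=.
  by ring.
exists E, (t * (2 * e)); split; first exact: tp.
- have -> : 1%:M - E = (2^-1)%:C%C *: 1%:M + (- t)%:C%C *: N; last exact: tm.
  rewrite /E opprD addrA rmorphN scaleNr; congr (_ - _).
  rewrite -[X in X - _]scale1r -scalerBl -(rmorph1 (real_complex R)) -rmorphB.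
  by congr (_%:C%C *: _); lra.
- by rewrite !mulr_gt0.
- by move=> s; rewrite trE // lerD2l !ler_pM2l // lerBrDl.
- move=> s; rewrite trE // lerD2l -mulrN -mulrN !ler_pM2l //.
  by rewrite lerBlDl.
Qed.

End SeparatingEffect.

(** * Binary codes and their decoding *)

Section BinaryCode.
Variable R : realFieldType.

(** Averaging: the words chosen so far have total weight below [th * #|T|] over all candidates, so
    some candidate has total weight below [th] against all of them together. *)
Lemma greedy_code (T : finType) (W : T -> T -> R) (B th : R) (M : nat) :
  (forall c c', 0 <= W c c') -> (forall c c', W c c' = W c' c) -> 0 < B ->
  (0 < #|T|)%N -> (forall c, \sum_c' W c c' <= B) -> M%:R * B <= th * #|T|%:R ->
  exists x : 'I_M -> T, forall i j, i != j -> W (x i) (x j) <= th.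
Proof.
move=> W0 Wsym B0 T0 WB hM.
suff [x hx] : exists x : nat -> T, forall i j, (i < j < M)%N -> W (x i) (x j) <= th.
  exists (fun i => x i) => i j; rewrite neq_ltn => /orP[] ij; first by rewrite hx // ij /=.
  by rewrite Wsym hx // ij /=.
elim: M hM => [|M IH] hM.
  by case/card_gt0P: T0 => c _; exists (fun _ => c) => i j; rewrite ltn0 andbF.
have hM' : M%:R * B < th * #|T|%:R.
  by apply: lt_le_trans hM; rewrite ltr_pM2r // ltr_nat.
have [x hx] := IH (ltW hM').
have [c hc] : exists c, \sum_(j < M) W (x j) c < th.
  apply/existsP; apply: contraLR hM'; rewrite negb_exists -leNgt => /forallP hc.
  apply: (@le_trans _ _ (\sum_c \sum_(j < M) W (x j) c)).
    rewrite mulr_natr -sumr_const; apply: ler_sum => c _; by rewrite leNgt hc.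
  rewrite exchange_big mulr_natl -[X in _ *+ X]card_ord -sumr_const.
  by apply: ler_sum => j _.
exists (fun j => if (j < M)%N then x j else c) => i j /andP[ij]; rewrite ltnS => jM.
rewrite (leq_trans ij jM); case: ltnP => jM'; first by rewrite hx // ij.
apply: le_trans (ltW hc); rewrite (bigD1 (Ordinal (leq_trans ij jM))) //= lerDl.
exact: sumr_ge0.
Qed.

Variable l : nat.
Implicit Types c y : {ffun 'I_l -> bool}.

(* [rho] to the power of the Hamming distance *)
Definition hdecay (rho : R) c c' : R := \prod_k (if c k == c' k then 1 else rho).

Lemma hdecay_sym rho c c' : hdecay rho c c' = hdecay rho c' c.
Proof. by apply: eq_bigr => k _; rewrite eq_sym. Qed.

Lemma hdecay_ge0 rho c c' : 0 <= rho -> 0 <= hdecay rho c c'.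
Proof. by move=> r0; apply: prodr_ge0 => k _; case: ifP. Qed.

Lemma sum_hdecay rho c : \sum_c' hdecay rho c c' = (1 + rho) ^+ l.
Proof.
rewrite -(bigA_distr_bigA (fun k b => if c k == b then 1 else rho)).
rewrite -[in RHS](card_ord l) -prodr_const; apply: eq_bigr => k _.
by rewrite big_bool; case: (c k) => //=; rewrite addrC.
Qed.

Variable lam : R.
Hypothesis lam1 : 1 < lam.

(* [lam] to the power of the number of agreements of [c] and [y] *)
Definition score c y : R := \prod_k (if y k == c k then lam else 1).

Lemma score_gt0 c y : 0 < score c y.
Proof.
by apply: prodr_gt0 => k _; case: ifP => // _; apply: lt_trans lam1.
Qed.

(** Chernoff-type bound: on the event summed over, the ratio of scores is at least 1, so the
    probability is at most the mean of this ratio. The mean factors over positions, giving 1 where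
    the words agree and at most [rho] where they differ. *)
Lemma pairwise_error (V : 'I_l -> bool -> R) (rho : R) c c' :
  (forall k b, 0 <= V k b) -> (forall k, V k true + V k false = 1) ->
  (forall k, V k (c k) / lam + (1 - V k (c k)) * lam <= rho) ->
  \sum_(y : {ffun 'I_l -> bool} | score c y <= score c' y) \prod_k V k (y k) <= hdecay rho c c'.
Proof.
move=> V0 V1 hV.
have lam0 : 0 < lam by apply: lt_trans lam1.
have P0 y : 0 <= \prod_k V k (y k) by apply: prodr_ge0.
pose G k b := V k b * ((if b == c' k then lam else 1) / (if b == c k then lam else 1)).
have GE y : \prod_k G k (y k) = (\prod_k V k (y k)) * (score c' y / score c y).
  by rewrite /score -prodf_div -big_split.
apply: (@le_trans _ _ (\sum_(y : {ffun 'I_l -> bool}) \prod_k G k (y k))).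
  rewrite big_mkcond; apply: ler_sum => y _; rewrite GE; case: ifP => [h|_].
    by rewrite ler_peMr // ler_pdivlMr ?score_gt0 // mul1r.
  by rewrite mulr_ge0 // divr_ge0 // ltW // score_gt0.
rewrite -(bigA_distr_bigA G); apply: ler_prod => k _; apply/andP; split.
  by apply: sumr_ge0 => b _; rewrite mulr_ge0 // divr_ge0 //; case: ifP => _ //; rewrite ltW.
have := hV k; have := V1 k; rewrite big_bool /G; case: (c k); case: (c' k) => /= h1 h2;
  rewrite ?divff ?gt_eqF // ?mulr1 ?divr1 ?h1 //.
- by move: h2; rewrite mul1r -h1 [V k true + _]addrC addrK.
- by move: h2; rewrite mul1r -h1 addrK addrC.
Qed.

(** Since [lam > 1], the highest score means the least Hamming distance. Ties are left undecoded,
    which keeps the decoding regions disjoint. *)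
Definition decodes M (x : 'I_M -> {ffun 'I_l -> bool}) i y : bool :=
  [forall j, (j != i) ==> (score (x j) y < score (x i) y)].

Lemma decodes_inj M (x : 'I_M -> {ffun 'I_l -> bool}) i j y :
  decodes x i y -> decodes x j y -> i = j.
Proof.
move=> /forallP/(_ j)/implyP hi /forallP/(_ i)/implyP hj; apply/eqP; apply: contraT => ij.
by have := lt_trans (hj ij) (hi _); rewrite ltxx eq_sym; apply.
Qed.

Lemma decoding_error M (x : 'I_M -> {ffun 'I_l -> bool}) (V : 'I_l -> bool -> R) (rho th : R) i :
  (forall k b, 0 <= V k b) -> (forall k, V k true + V k false = 1) ->
  (forall k, V k (x i k) / lam + (1 - V k (x i k)) * lam <= rho) ->
  0 <= th -> (forall j, i != j -> hdecay rho (x i) (x j) <= th) ->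
  \sum_(y | ~~ decodes x i y) \prod_k V k (y k) <= M%:R * th.
Proof.
move=> V0 V1 hV th0 hx.
have P0 (y : {ffun 'I_l -> bool}) : 0 <= \prod_k V k (y k) by apply: prodr_ge0.
apply: (@le_trans _ _ (\sum_(j < M | j != i)
    \sum_(y : {ffun 'I_l -> bool} | score (x i) y <= score (x j) y) \prod_k V k (y k))).
  rewrite (exchange_big_dep predT) //= big_mkcond; apply: ler_sum => y _.
  case: ifP => [|_]; last by apply: sumr_ge0.
  rewrite negb_forall => /existsP[j]; rewrite negb_imply -leNgt => hj.
  by rewrite (bigD1 j) //= lerDl sumr_ge0.
apply: (@le_trans _ _ (\sum_(j < M) th)); last by rewrite sumr_const card_ord mulr_natl.
rewrite big_mkcond; apply: ler_sum => j _; case: ifP => // ji.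
by apply: le_trans (pairwise_error (x j) V0 V1 hV) _; apply: hx; rewrite eq_sym.
Qed.

End BinaryCode.

(** * From a binary code to a quantum code *)

Section MeasuredCode.
Variables (R : realType) (X S : finType) (n : nat).
Local Notation C := R[i].
Variable A : S -> X -> 'M[C]_n.
Hypothesis hA : AVcqC A.
Variables (letter : bool -> X) (E : bool -> 'M[C]_n) (e : R).
Hypotheses (E_psd : forall b, psd (E b)) (E_sum : E true + E false = 1%:M).
Hypothesis E_sep : forall s b, 2^-1 + e <= complex.Re (\tr (A s (letter b) *m E b)).

Definition outcome l (y : {ffun 'I_l -> bool}) : 'M[C]_(n ^ l) := tensn (fun k => E (y k)).

Lemma outcome_psd l (y : {ffun 'I_l -> bool}) : psd (outcome y).
Proof. exact: tensn_psd. Qed.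

Lemma sum_outcome l : \sum_(y : {ffun 'I_l -> bool}) outcome y = 1%:M.
Proof.
rewrite -(tensn_sum (fun _ => E)) -(tensn1 R n l); apply: eq_tensn => k.
by rewrite big_bool.
Qed.

Definition outcome_prob (s : S) (b b' : bool) : R := complex.Re (\tr (A s (letter b) *m E b')).

Lemma outcome_prob_ge0 s b b' : 0 <= outcome_prob s b b'.
Proof. by apply: cRe_ge0; apply: trace_mul_psd_ge0 => //; case: (hA s (letter b)). Qed.

Lemma outcome_prob_sum s b : outcome_prob s b true + outcome_prob s b false = 1.
Proof.
rewrite /outcome_prob -cReD -mxtraceD -mulmxDr E_sum mulmx1.
by case: (hA s (letter b)) => _ ->.
Qed.

Definition measured_code l (lam : R) M (x : 'I_M -> {ffun 'I_l -> bool}) : Defs.code R X n l :=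
  @Code R X n l M (fun i => [tuple letter (x i k) | k < l])
    (fun i => \sum_(y | decodes lam x i y) outcome y).

(** The regions are disjoint, so what remains of the identity is the sum of the undecoded
    outcomes. *)
Lemma measured_code_valid l lam M (x : 'I_M -> {ffun 'I_l -> bool}) :
  code_valid (measured_code lam x).
Proof.
split=> /= [i|]; first by apply: psd_sum => y _; exact: outcome_psd.
rewrite -sum_outcome (exchange_big_dep predT) //= -sumrB; apply: psd_sum => y _.
have [i di|nd] := pickP (fun i => decodes lam x i y).
  rewrite (big_pred1 i) ?subrr; first exact: psd0.
  move=> j /=; apply/idP/eqP => [dj|->//].
  exact: decodes_inj dj di.
by rewrite big_pred0 // subr0; exact: outcome_psd.
Qed.

Lemma measured_code_err l lam rho th M (x : 'I_M -> {ffun 'I_l -> bool}) :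
  1 < lam -> 0 <= th ->
  (forall w, 2^-1 + e <= w -> w / lam + (1 - w) * lam <= rho) ->
  (forall i j, i != j -> hdecay rho (x i) (x j) <= th) ->
  max_err A (measured_code lam x) <= M%:R * th.
Proof.
move=> lam1 th0 hrho hx; have Mth0 : 0 <= M%:R * th by rewrite mulr_ge0.
apply: bigmax_le => // s _; apply: bigmax_le => //= i _.
rewrite -sum_outcome (bigID (decodes lam x i)) /= addrC addrK.
pose V k b := outcome_prob (tnth s k) (x i k) b.
have trE y : complex.Re (\tr (tensA A s [tuple letter (x i k) | k < l] *m outcome y))
    = \prod_k V k (y k).
  rewrite /tensA tensn_mul tensn_tr (eq_bigr (fun k => (V k (y k))%:C%C)) -?rmorph_prod // => k _.
  rewrite /V /outcome_prob tnth_mktuple ge0_cReK //.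
  by apply: trace_mul_psd_ge0 => //; case: (hA (tnth s k) (letter (x i k))).
set Y := tensA _ _ _ in trE *; set Z := \sum_(y | _) _.
rewrite mulmx_sumr mxtrace_sum cRe_sum (eq_bigr _ (fun y _ => trE y)).
apply: (@decoding_error _ _ _ lam1 _ _ _ rho) => // k *.
- exact: outcome_prob_ge0.
- exact: outcome_prob_sum.
- by apply: hrho; exact: E_sep.
- exact: hx.
Qed.

End MeasuredCode.

(** For [lam > 1] the expression decreases in [w], so only [w = 1/2 + e] matters; there
    [lam = 1 + e] brings it below 1. *)
Lemma bsc_decay (R : realFieldType) (e : R) : 0 < e ->
  exists lam rho : R, [/\ 1 < lam, 0 < rho < 1 &
    forall w, 2^-1 + e <= w -> w / lam + (1 - w) * lam <= rho].
Proof.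
move=> e0; pose lam := 1 + e; have lam1 : 1 < lam by rewrite ltrDl.
have lam0 : 0 < lam by apply: lt_trans lam1.
(* The maximum with 1/2 ensures [0 < rho], since the other term is negative for large [e]. *)
exists lam, (Num.max 2^-1 ((2^-1 + e) / lam + (2^-1 - e) * lam)); split=> // [|w hw].
  rewrite lt_max invr_gt0 ltr0n /= gt_max; apply/andP; split; first by lra.
  rewrite -(ltr_pM2r lam0) mulrDl mulfVK ?gt_eqF // mul1r /lam.
  have : 0 < e * e by rewrite mulr_gt0.
  have : 0 < e * e * e by rewrite !mulr_gt0.
  by nra.
rewrite le_max; apply/orP; right; rewrite -subr_ge0.
have -> : (2^-1 + e) / lam + (2^-1 - e) * lam - (w / lam + (1 - w) * lam)
  = (w - (2^-1 + e)) * (lam - lam^-1) by field; rewrite gt_eqF.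
by rewrite mulr_ge0 // subr_ge0 // ltW // (lt_trans _ lam1) // invf_lt1.
Qed.

Import numFieldNormedType.Exports.

(** For [2 ^ (l %/ c)] words, the first inequality is the counting condition of the greedy choice
    with threshold [tau ^+ l], and the second makes the union bound exponentially small. *)
Lemma expansion_rate (R : realType) (rho : R) : 0 < rho < 1 ->
  exists (tau sig : R) (c : nat), [/\ 0 < tau, 0 < sig < 1, (0 < c)%N &
    forall l, (2 ^ (l %/ c))%:R * (1 + rho) ^+ l <= tau ^+ l * 2 ^+ l /\
              (2 ^ (l %/ c))%:R * tau ^+ l <= sig ^+ l].
Proof.
move=> /andP[rho0 rho1]; pose kap := (1 + rho) / 2.
have kap0 : 0 < kap by rewrite divr_gt0 // addr_gt0.
have kap1 : kap < 1 by rewrite /kap; lra.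
pose tau := (1 + kap) / 2.
have tau1 : tau < 1 by rewrite /tau; lra.
have ktau : kap < tau by rewrite /tau; lra.
have tau0 : 0 < tau by apply: lt_trans ktau.
(* The room between [kap], [tau] and 1 allows a growth rate [eta > 1] for the number of words. *)
have [eta [eta1 etak etat]] : exists eta, [/\ 1 < eta, eta * kap <= tau & eta * tau < 1].
  exists (Num.min (tau / kap) ((1 + tau^-1) / 2)); split.
  - rewrite lt_min ltr_pdivlMr // mul1r ktau /=.
    have : 1 < tau^-1 by rewrite invf_gt1.
    lra.
  - by rewrite -ler_pdivlMr // ge_min lexx.
  - rewrite -ltr_pdivlMr // mul1r gt_min; apply/orP; right.
    have : 1 < tau^-1 by rewrite invf_gt1.
    lra.
have eta0 : 0 < eta by apply: lt_trans eta1.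
(* Some power of [eta] reaches 2, hence one bit per [c] positions grows no faster than
   [eta ^+ l]. *)
have [c c0 hc] : exists2 c : nat, (0 < c)%N & 2 <= eta ^+ c.
  have /cvgrPdist_lt : ((GRing.exp (eta^-1) : R^nat) @ \oo --> (0 : R))%classic.
    by apply: cvg_expr; rewrite gtr0_norm ?invr_gt0 // invf_lt1.
  move=> /(_ 2^-1) []; first by rewrite invr_gt0.
  move=> N _ /(_ N.+1) /(_ (leqnSn _)) /=.
  rewrite sub0r normrN gtr0_norm ?exprn_gt0 ?invr_gt0 // exprVn ltf_pV2 ?posrE ?exprn_gt0 //.
  by move=> /ltW ?; exists N.+1.
have h2 l : (2 ^ (l %/ c))%:R <= eta ^+ l.
  rewrite {2}(divn_eq l c) exprD mulnC exprM natrX.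
  apply: (@le_trans _ _ ((eta ^+ c) ^+ (l %/ c))); first by rewrite lerXn2r ?nnegrE ?exprn_ge0 // ltW.
  by rewrite ler_peMr ?exprn_ge0 ?exprn_ege1 // ltW.
exists tau, (eta * tau), c; split=> // [|l]; first by rewrite etat andbT; apply: mulr_gt0.
split.
  have -> : 1 + rho = kap * 2 by rewrite /kap mulfVK.
  rewrite exprMn mulrA ler_wpM2r ?exprn_ge0 //.
  apply: le_trans (ler_wpM2r (exprn_ge0 _ (ltW kap0)) (h2 l)) _.
  by rewrite -exprMn; apply: lerXn2r => //; rewrite nnegrE ltW // mulr_gt0.
by rewrite (exprMn _ eta tau) ler_wpM2r ?exprn_ge0 // ltW.
Qed.

(** * Achievable rates and the capacity *)

Section Capacity.
Variables (R : realType) (X S : finType) (n : nat).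
Local Notation C := R[i].
Variable A : S -> X -> 'M[C]_n.
Hypothesis hA : AVcqC A.

Lemma separated_codes (x x' : X) :
  ~ (exists p q : S -> R, [/\ forall s, 0 <= p s, \sum_s p s = 1, forall s, 0 <= q s,
     \sum_s q s = 1 & \sum_s (p s)%:C%C *: A s x = \sum_s (q s)%:C%C *: A s x']) ->
  exists (sig : R) (c : nat), [/\ 0 < sig < 1, (0 < c)%N & forall l,
    exists K : Defs.code R X n l, [/\ code_valid K, csize K = (2 ^ (l %/ c))%N &
      max_err A K <= sig ^+ l]].
Proof.
move=> nsym; have [//|[E [e [E0 E1 e0 hx hx']]]] :=
  separating_effect (fun s => hA s x) (fun s => hA s x').
have [lam [rho [lam1 rho01 hrho]]] := bsc_decay e0.
have /andP[rho0 rho1] := rho01.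
have [tau [sig [c [tau0 sig01 c0 hc]]]] := expansion_rate rho01.
exists sig, c; split=> // l; have [hsize herr] := hc l.
pose letter (b : bool) := if b then x else x'.
(* Complementing turns the upper bound for [x'] into the lower bound required of the outcome
   [false]. *)
pose F (b : bool) := if b then E else 1%:M - E.
have Fpsd b : psd (F b) by case: b.
have Fsum : F true + F false = 1%:M by rewrite /F addrC subrK.
have Fsep s b : 2^-1 + e <= complex.Re (\tr (A s (letter b) *m F b)).
  case: b => //=; rewrite mulmxBr mulmx1 raddfB /=; case: (hA s x') => _ ->.
  have -> : complex.Re (1 - \tr (A s x' *m E)) = 1 - complex.Re (\tr (A s x' *m E)).
    by case: (\tr _).
  by have := hx' s; lra.
have [||||||K hK] := @greedy_code R {ffun 'I_l -> bool} (hdecay rho) ((1 + rho) ^+ l)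
    (tau ^+ l) (2 ^ (l %/ c)).
- by move=> *; apply: hdecay_ge0; apply: ltW.
- exact: hdecay_sym.
- by rewrite exprn_gt0 // addr_gt0.
- by rewrite card_ffun card_bool card_ord expn_gt0.
- by move=> w; rewrite sum_hdecay.
- by rewrite card_ffun card_bool card_ord (natrX _ 2 l).
exists (measured_code letter F lam K); split=> //; first exact: measured_code_valid.
apply: le_trans herr.
by apply: (measured_code_err hA Fpsd Fsum Fsep lam1 _ hrho hK); rewrite exprn_ge0 // ltW.
Qed.

Lemma separated_achievable (x x' : X) :
  ~ (exists p q : S -> R, [/\ forall s, 0 <= p s, \sum_s p s = 1, forall s, 0 <= q s,
     \sum_s q s = 1 & \sum_s (p s)%:C%C *: A s x = \sum_s (q s)%:C%C *: A s x']) ->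
  exists2 r : R, 0 < r & achievable A r.
Proof.
move=> /separated_codes[sig [c [/andP[sig0 sig1] c0 hK']]].
pose K l := projT1 (cid (hK' l)); have hK l := projT2 (cid (hK' l)).
have ln2 : 0 < ln (2 : R) by rewrite ln_gt0 // ltr1n.
have c0' : 0 < (2 * c)%:R :> R by rewrite ltr0n muln_gt0.
(* The factor 2 absorbs rounding: [l %/ c] is at least [l / (2 * c)] as soon as [c <= l]. *)
exists (ln 2 / (2 * c)%:R); first by rewrite divr_gt0.
split; first by rewrite ltW // divr_gt0.
exists K; split=> [l|]; first by case: (hK l).
split.
  rewrite limn_einf_lim; apply: lime_ge; first exact: is_cvg_einfs.
  exists c => // m /= cm; apply: le_ereal_inf_tmp => _ [l /= ml <-].
  have cl := leq_trans cm ml; have l0 := leq_trans c0 cl.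
  rewrite lee_fin; case: (hK l) => _ -> _.
  rewrite (natrX _ 2 (l %/ c)) lnXn // -[ln 2 *+ _]mulr_natr -mulrA ler_pM2l // ler_pdivlMr ?ltr0n //.
  rewrite mulrC ler_pdivrMr // -natrM ler_nat.
  apply: leq_trans (ltnW (ltn_ceil l c0)) _.
  by rewrite mulnA leq_mul2r muln2 -addnn -addn1 leq_add2l divn_gt0 // cl orbT.
apply: (@squeeze_cvgr _ _ _ _ (fun=> 0) (GRing.exp sig)) => //.
- apply: nearW => l /=; case: (hK l) => _ _ ->; rewrite andbT.
  exact: bigmax_ge_id.
- exact: cvg_cst.
- by apply: cvg_expr; rewrite gtr0_norm.
Qed.

(** The jammer draws states independently at each position: by multilinearity the output is the
    average of [tensA A s w] under the product distribution. *)
Lemma mixture_err l (p : 'I_l -> S -> R) (w : l.-tuple X) (D : 'M[C]_(n ^ l)) (err : R) :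
  (forall k s, 0 <= p k s) -> (forall k, \sum_s p k s = 1) ->
  (forall s : l.-tuple S, complex.Re (\tr (tensA A s w *m D)) <= err) ->
  complex.Re (\tr (tensn (fun k => \sum_s (p k s)%:C%C *: A s (tnth w k)) *m D)) <= err.
Proof.
move=> p0 p1 herr; rewrite tensn_sum mulmx_suml.
have -> : \tr (\sum_(f : {ffun 'I_l -> S})
      tensn (fun k => (p k (f k))%:C%C *: A (f k) (tnth w k)) *m D)
    = \sum_(f : {ffun 'I_l -> S})
      (\prod_k p k (f k))%:C%C * \tr (tensA A [tuple f k | k < l] w *m D).
  rewrite mxtrace_sum; apply: eq_bigr => f _.
  rewrite tensnZ -scalemxAl mxtraceZ -rmorph_prod; congr (_ * \tr (_ *m _)).
  by apply: eq_tensn => k; rewrite tnth_mktuple.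
rewrite cRe_sum; under eq_bigr do rewrite cReZ.
have -> : err = \sum_(f : {ffun 'I_l -> S}) (\prod_k p k (f k)) * err.
  by rewrite -mulr_suml -(bigA_distr_bigA p) big1 ?mul1r.
by apply: ler_sum => f _; rewrite ler_wpM2l // prodr_ge0.
Qed.

Lemma m_symmetrizable_err l (c : Defs.code R X n l) :
  m_symmetrizable A -> code_valid c -> (1 < csize c)%N -> 2^-1 <= max_err A c.
Proof.
move=> hsym [hD hDs] c1.
pose D (i : 'I_(csize c)) := cdec i.
pose i0 : 'I_(csize c) := Ordinal (ltnW c1); pose i1 : 'I_(csize c) := Ordinal c1.
have hmax (i : 'I_(csize c)) (s : l.-tuple S) : complex.Re (\tr (tensA A s (cword i) *m (1%:M - D i))) <= max_err A c.
  by apply: (bigmax_sup s) => //; apply: (bigmax_sup i).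
have /choice[p /choice[q hpq]] := fun k => hsym (tnth (cword i0) k) (tnth (cword i1) k).
pose rho k : 'M[C]_n := \sum_s (p k s)%:C%C *: A s (tnth (cword i0) k).
have rho1 k : rho k = \sum_s (q k s)%:C%C *: A s (tnth (cword i1) k) by case: (hpq k).
have e0 : complex.Re (\tr (tensn rho *m (1%:M - D i0))) <= max_err A c.
  by apply: mixture_err => // k; case: (hpq k).
have e1 : complex.Re (\tr (tensn rho *m (1%:M - D i1))) <= max_err A c.
  by rewrite (eq_tensn rho1); apply: mixture_err => // k; case: (hpq k).
have rho_psd : psd (tensn rho).
  apply: tensn_psd => k; apply: psd_sum => s _; apply: psdZ; last by case: (hA s (tnth (cword i0) k)).
  by rewrite ler0c; case: (hpq k).
have rho_tr : \tr (tensn rho) = 1.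
  rewrite tensn_tr big1 // => k _; rewrite mxtrace_sum.
  case: (hpq k) => _ p1 _ _ _; rewrite -(rmorph1 (real_complex R)) -p1 rmorph_sum.
  apply: eq_bigr => s _; rewrite [LHS]mxtraceZ.
  by case: (hA s (tnth (cword i0) k)) => _ ->; rewrite mulr1.
(* This is the unassigned part of the identity plus the decoders of the other words. *)
have rest : psd (1%:M - D i0 - D i1).
  have -> : 1%:M - D i0 - D i1 = (1%:M - \sum_i D i)
      + \sum_(i | (i != i0) && (i != i1)) D i.
    by rewrite (bigD1 i0) //= (bigD1 i1) //= !opprD !addrA subrK.
  by apply: psdD => //; apply: psd_sum.
have := cRe_ge0 (trace_mul_psd_ge0 rho_psd rest).
have : complex.Re (\tr (tensn rho *m (1%:M - D i0))) +
    complex.Re (\tr (tensn rho *m (1%:M - D i1))) =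
    1 + complex.Re (\tr (tensn rho *m (1%:M - D i0 - D i1))).
  have -> : 1 = complex.Re (\tr (tensn rho)) by rewrite rho_tr.
  rewrite -!cReD -!mxtraceD -mulmxDr -[X in _ = complex.Re (\tr (X + _))]mulmx1 -mulmxDr.
  by rewrite [in RHS]addrCA.
move: e0 e1; lra.
Qed.

(** Errors below 1/2 leave at most one word from some length on, so the rate is eventually 0. *)
Lemma m_symmetrizable_achievable r : m_symmetrizable A -> achievable A r -> r <= 0.
Proof.
move=> hsym [r0 [c [cv [rate err]]]].
suff u0 : ((fun l => (ln (csize (c l))%:R / l%:R)%:E : \bar R) @ \oo --> (0%:E : \bar R))%classic.
  by rewrite -lee_fin; apply: le_trans rate _; rewrite (cvg_limn_einf_sup u0).1.
apply: cvg_near_cst; move/cvgrPdist_lt: err => /(_ 2^-1).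
rewrite invr_gt0 ltr0n => /(_ isT) [N _ hN]; exists N => // l /= Nl.
have := hN l Nl; rewrite /= sub0r normrN => /(le_lt_trans (ler_norm _)) small.
have : (csize (c l) <= 1)%N.
  by rewrite leqNgt; apply: contraTN small => c1; rewrite -leNgt; apply: m_symmetrizable_err.
(* [ln 0] is 0 here, so an empty code has the same rate as a single word. *)
by case: (csize (c l)) => [|[|//]] _; [rewrite ln0 // | rewrite ln1]; rewrite mul0r.
Qed.

(* The empty code has rate [ln 0 / l = 0]; it also covers an empty [X]. *)
Lemma achievable0 : achievable A 0.
Proof.
split=> //; exists (fun l => @Code R X n l 0 (fun i => False_rect _ (notF (ltn_ord i))) (fun=> 0)).
split=> [l|].
  split=> [i|]; first exact: psd0.
  by rewrite /= big_ord0 subr0 => v; rewrite mulmx1; exact: adjmx_self_ge0.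
split.
  have -> : (fun l : nat => (ln (0%:R : R) / l%:R)%:E) = (fun=> 0%:E).
    by apply/funext => l; rewrite ln0 ?mul0r.
  by rewrite (cvg_limn_einf_sup (cvg_cst (0%:E : \bar R))).1.
have -> : (fun l => max_err A (@Code R X n l 0 (fun i => False_rect _ (notF (ltn_ord i))) (fun=> 0)) : R^o)
    = (fun=> 0).
  apply/funext => l; apply: le_anti; rewrite bigmax_ge_id andbT.
  by apply: bigmax_le => // s _; rewrite big_ord0.
exact: cvg_cst.
Qed.

End Capacity.

Theorem theorem4 (R : realType) (X S : finType) (n : nat)
  (A : S -> X -> 'M[R[i]]_n) (hA : AVcqC A) :
  CAd A = 0%E <-> m_symmetrizable A.
Proof.
split=> [C0 x x'|hsym].
  apply: contrapT => /(separated_achievable hA)[r r0 hr].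
  have : (r%:E <= CAd A)%E by apply: ereal_sup_ubound; exists r.
  by rewrite C0 lee_fin leNgt r0.
apply/le_anti/andP; split.
  apply: ge_ereal_sup => _ [r hr <-]; rewrite lee_fin.
  exact: m_symmetrizable_achievable hr.
(* The set of achievable rates must contain 0: the supremum of an empty set would be [-oo]. *)
by apply: ereal_sup_ubound; exists 0 => //; exact: achievable0.
Qed.
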